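(* Let $n\ge1$, $\mathcal I=\{1,\dots,n\}$, and let $\mathcal X$ and $\mathcal Y_i$ ($i\in\mathcal I$) be finite nonempty sets. Let $(\mathcal X,\mathcal Y_i,C_i)$, $i\in\mathcal I$, be channels and $\pi$ a prior on $\mathcal X$. Let $\mathcal X'$ be a nonempty proper subset of $\mathcal X$ with $\max_{x'\in\mathcal X'}\pi[x']\le\min_{x\in\mathcal X\setminus\mathcal X'}\pi[x]$, let $\epsilon=\sum_{x'\in\mathcal X'}\pi[x']$, and let $\pi'=\pi|_{\mathcal X\setminus\mathcal X'}$. Assume $\epsilon<\max_{j\in\mathcal I}V(\pi,C_j)$. Then $$I_\infty\bigl(\pi,\ \parallel_{i\in\mathcal I}C_i\bigr)\ \le\ \sum_{i\in\mathcal I}I_\infty(\pi,C_i)+(\#\mathcal I-1)\cdot\bigl(H^{\min}(\pi')-H_\infty(\pi')\bigr)+\log\frac{\max_{j\in\mathcal I}V(\pi,C_j)}{\max_{j\in\mathcal I}V(\pi,C_j)-\epsilon}.$$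
   Context: A (discrete) channel $(\mathcal X,\mathcal Y,C)$ consists of finite sets $\mathcal X,\mathcal Y$ and a matrix $C$ with entries $C[x,y]\ge 0$ and $\sum_{y}C[x,y]=1$ for each $x$. A prior on $\mathcal X$ is a probability distribution on $\mathcal X$. The $n$-ary parallel composition with shared input $\parallel_{i\in\mathcal I}C_i$ is the channel from $\mathcal X$ to $\mathcal Y_1\times\cdots\times\mathcal Y_n$ whose entry at $(x,(y_1,\dots,y_n))$ is $\prod_i C_i[x,y_i]$. The sub-probability distribution $\pi|_{\mathcal X\setminus\mathcal X'}$ on $\mathcal X$ equals $0$ at $x\in\mathcal X'$ and $\pi[x]$ at $x\notin\mathcal X'$. For a (sub-)probability distribution $\pi$ on $\mathcal X$: $V(\pi)=\max_{x}\pi[x]$, $V(\pi,C)=\sum_y\max_x\pi[x]C[x,y]$, $H_\infty(\pi)=-\log V(\pi)$, $H_\infty(\pi,C)=-\log V(\pi,C)$, $I_\infty(\pi,C)=H_\infty(\pi)-H_\infty(\pi,C)$ (min-entropy leakage), and $H^{\min}(\pi)=-\log\min\{\pi[x]: x\in\mathcal X,\ \pi[x]\ne0\}$. Logarithms are to base 2. *)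

(* Defs.v *)
From mathcomp Require Import all_boot all_order all_algebra.
From mathcomp Require Import reals exp.

Set Implicit Arguments.
Unset Strict Implicit.
Unset Printing Implicit Defensive.

Import Order.TTheory GRing.Theory Num.Theory.
Local Open Scope ring_scope.

Definition log2 {R : realType} (x : R) : R := ln x / ln 2.

Definition is_prior {R : realType} {X : finType} (pi : X -> R) : Prop :=
  (forall x, 0 <= pi x) /\ \sum_x pi x = 1.

Definition is_channel {R : realType} {X Y : finType} (C : X -> Y -> R) : Prop :=
  (forall x y, 0 <= C x y) /\ (forall x, \sum_y C x y = 1).

(* An output of the composition is a tuple (y_i)_i with y_i in Y i. *)
Definition parallel {R : realType} {I X : finType} {Y : I -> finType}
    (C : forall i, X -> Y i -> R) (x : X) (y : {dffun forall i, Y i}) : R :=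
  \prod_i C i x (y i).

Definition restrict {R : realType} {X : finType} (pi : X -> R) (A : {set X})
    (x : X) : R :=
  if x \in A then pi x else 0.

(* Throughout, pi and C take values in [0, 1]: the default value 0 of an
   iterated maximum and the default value 1 of an iterated minimum therefore do
   not change the maximum or minimum of a nonempty family of such values. *)
Definition V {R : realType} {X : finType} (pi : X -> R) : R :=
  \big[Num.max/0]_x pi x.

Definition Vpost {R : realType} {X Y : finType} (pi : X -> R)
    (C : X -> Y -> R) : R :=
  \sum_y \big[Num.max/0]_x (pi x * C x y).

Definition Hinf {R : realType} {X : finType} (pi : X -> R) : R :=
  - log2 (V pi).

Definition Hinf_post {R : realType} {X Y : finType} (pi : X -> R)
    (C : X -> Y -> R) : R :=
  - log2 (Vpost pi C).

Definition Iinf {R : realType} {X Y : finType} (pi : X -> R)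
    (C : X -> Y -> R) : R :=
  Hinf pi - Hinf_post pi C.

Definition Hmin {R : realType} {X : finType} (pi : X -> R) : R :=
  - log2 (\big[Num.min/1]_(x | pi x != 0) pi x).

Lemma parallel_channel {R : realType} {I X : finType} {Y : I -> finType}
    (C : forall i, X -> Y i -> R) :
  (forall i, is_channel (C i)) -> is_channel (parallel C).
Proof.
move=> hC; split=> [x y|x]; first by apply: prodr_ge0 => i _; case: (hC i).
pose P i := [ffun z => C i x z] : {ffun Y i -> R}.
rewrite (reindex (@dffun_of_fprod I Y)) /=; last first.
  exact/onW_bij/dffun_of_fprod_bij.
transitivity (\sum_(t : fprod Y) \prod_(i in I) P i (t i)).
  by apply: eq_bigr => t _; apply: eq_bigr => i _; rewrite !ffunE.
rewrite big_fprod -(bigA_distr_big_dep _ (fun i => untag 0 (P i))).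
apply: big1 => i _; rewrite -(big_tag P).
by rewrite -((hC i).2 x); apply: eq_bigr => y _; rewrite ffunE.
Qed.

(* Main.v *)
Require Import Defs.
From mathcomp Require Import all_boot all_order all_algebra.
From mathcomp Require Import reals exp.
From mathcomp Require Import lra.

Set Implicit Arguments.
Unset Strict Implicit.
Unset Printing Implicit Defensive.

Import Order.TTheory GRing.Theory Num.Theory.
Local Open Scope ring_scope.

(** Write [W] for the posterior vulnerability of the composition, [V_i] for that
    of [C_i], [M] for the largest [V_i], and [a] for the least nonzero prior
    probability outside [X'].  For [x] outside [X'] of positive probability,
    [pi x * \prod_i C_i x y_i] equals [\prod_i (pi x * C_i x y_i)] divided by
    [pi x ^ (n - 1)], hence is at most [a ^- (n - 1)] times a product of the
    summands of the [V_i]; the secrets in [X'] contribute at most [eps] in total.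
    So [W <= a ^- (n - 1) * \prod_i V_i + eps].  Discarding all components but
    one does not increase the vulnerability, so [M <= W], whence
    [W * (M - eps) / M <= W - eps], and the claim is the logarithm of the
    resulting bound on [W]. *)

Lemma ln2_gt0 (R : realType) : 0 < ln (2 : R).
Proof. by apply: ln_gt0; rewrite ltr1n. Qed.

Lemma log2M (R : realType) (x y : R) :
  0 < x -> 0 < y -> log2 (x * y) = log2 x + log2 y.
Proof. by move=> x0 y0; rewrite /log2 lnM ?posrE// mulrDl. Qed.

Lemma log2_prod (R : realType) (I : finType) (F : I -> R) :
  (forall i, 0 < F i) -> log2 (\prod_i F i) = \sum_i log2 (F i).
Proof.
move=> F0.
suff [] : 0 < \prod_i F i /\ log2 (\prod_i F i) = \sum_i log2 (F i) by [].
apply: (big_ind2 (fun p s => 0 < p /\ log2 p = s)) => [|p s q t [p0 <-] [q0 <-]|//].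
  by rewrite /log2 ln1 mul0r.
by rewrite mulr_gt0 // log2M.
Qed.

Lemma ler_log2 (R : realType) (x y : R) : 0 < x -> x <= y -> log2 x <= log2 y.
Proof.
move=> x0 xy; rewrite /log2 ler_pM2r ?invr_gt0 ?ln2_gt0//.
by rewrite ler_ln ?posrE// (lt_le_trans x0).
Qed.

(** Distributivity of product over sum. Passing from dependent functions to [fprod] makes the
    version for tagged values applicable. *)
Lemma sum_dffun_prod (R : realType) (I : finType) (Y : I -> finType)
    (F : forall i, Y i -> R) :
  \sum_(y : {dffun forall i, Y i}) \prod_i F i (y i) = \prod_i \sum_z F i z.
Proof.
pose P i := [ffun z => F i z] : {ffun Y i -> R}.
rewrite (reindex (@dffun_of_fprod I Y)) /=; last first.
  exact/onW_bij/dffun_of_fprod_bij.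
transitivity (\sum_(t : fprod Y) \prod_(i in I) P i (t i)).
  by apply: eq_bigr => t _; apply: eq_bigr => i _; rewrite !ffunE.
rewrite big_fprod -(bigA_distr_big_dep _ (fun i => untag 0 (P i))).
apply: eq_bigr => i _; rewrite -(big_tag P).
by apply: eq_bigr => y _; rewrite ffunE.
Qed.

(** The constraint on [y j] is absorbed into the factor [j], so the sum factorises; every other
    factor is then a row sum, equal to 1. *)
Lemma parallel_marginal (R : realType) (I X : finType) (Y : I -> finType)
    (C : forall i, X -> Y i -> R) (hC : forall i, is_channel (C i))
    (j : I) (z : Y j) (x : X) :
  \sum_(y : {dffun forall i, Y i} | y j == z) parallel C x y = C j x z.
Proof.
(* Comparing tagged values avoids casting [y i : Y i] to [Y j]. *)
pose F i (w : Y i) : R :=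
  if (i == j) ==> (Tagged Y z == Tagged Y w) then C i x w else 0.
have FjE w : F j w = if z == w then C j x w else 0.
  by rewrite /F eqxx /= eq_Tagged.
transitivity (\sum_(y : {dffun forall i, Y i}) \prod_i F i (y i)).
  rewrite big_mkcond; apply: eq_bigr => y _; case: ifPn => [/eqP yjz|yjz].
    apply: eq_bigr => i _; rewrite /F; case: ifPn => //.
    by rewrite negb_imply => /andP[/eqP ij]; subst i; rewrite yjz eqxx.
  by rewrite (bigD1 j) //= FjE eq_sym (negbTE yjz) mul0r.
rewrite sum_dffun_prod (bigD1 j) //= [X in _ * X]big1 ?mulr1 => [|i ij].
  under eq_bigr do rewrite FjE eq_sym.
  by rewrite -big_mkcond /= big_pred1_eq.
rewrite -((hC i).2 x); apply: eq_bigr => w _.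
by rewrite /F (negbTE ij).
Qed.

(** Group the outputs by their component [j]: a maximum of sums is at most the sum of the maxima. *)
Lemma ler_Vpost_parallel (R : realType) (I X : finType) (Y : I -> finType)
    (C : forall i, X -> Y i -> R) (hC : forall i, is_channel (C i))
    (pi : X -> R) (j : I) :
  Vpost pi (C j) <= Vpost pi (parallel C).
Proof.
rewrite /Vpost (partition_big (fun y : {dffun forall i, Y i} => y j) predT) //=.
apply: ler_sum => z _; apply: bigmax_le => [|x _].
  by apply: sumr_ge0 => y _; apply: bigmax_ge_id.
rewrite -(parallel_marginal hC) mulr_sumr; apply: ler_sum => y _.
exact: (le_bigmax _ (fun x => pi x * parallel C x y)).
Qed.

Lemma ler_V_Vpost (R : realType) (X Y : finType) (pi : X -> R) (C : X -> Y -> R) :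
  is_channel C -> V pi <= Vpost pi C.
Proof.
move=> [_ C1]; apply: bigmax_le => [|x _].
  by apply: sumr_ge0 => y _; apply: bigmax_ge_id.
rewrite -[leLHS]mulr1 -(C1 x) mulr_sumr; apply: ler_sum => y _.
exact: (le_bigmax _ (fun x => pi x * C x y)).
Qed.

Lemma V_gt0 (R : realType) (X : finType) (pi : X -> R) : is_prior pi -> 0 < V pi.
Proof.
move=> [pi0 pi1]; rewrite lt_neqAle bigmax_ge_id andbT.
apply/negP => /eqP V0; have := oner_neq0 R; rewrite -pi1 big1 ?eqxx // => x _.
by apply/eqP; rewrite eq_le pi0 andbT V0 (le_bigmax _ pi).
Qed.

Lemma Vpost_parallel_le (R : realType) (n : nat) (X : finType)
    (Y : 'I_n.+1 -> finType) (C : forall i, X -> Y i -> R)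
    (hC : forall i, is_channel (C i)) (pi : X -> R) (pi_ge0 : forall x, 0 <= pi x)
    (X' : {set X}) (a : R) (a_gt0 : 0 < a)
    (ha : forall x, x \notin X' -> pi x != 0 -> a <= pi x) :
  Vpost pi (parallel C) <=
    \prod_i Vpost pi (C i) / a ^+ n + \sum_(x in X') pi x.
Proof.
pose U i (w : Y i) := \big[Num.max/0]_x (pi x * C i x w).
have U_ge0 i w : 0 <= U i w by apply: bigmax_ge_id.
have C_ge0 i x w : 0 <= C i x w by case: (hC i).
have P_ge0 x y : 0 <= parallel C x y by apply: prodr_ge0.
(* Spreading the mass of [X'] over the outputs reduces the claim to one inequality for each [y]. *)
have -> : \sum_(x in X') pi x =
    \sum_(y : {dffun forall i, Y i}) \sum_(x in X') pi x * parallel C x y.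
  rewrite exchange_big; apply: eq_bigr => x _.
  by rewrite -mulr_sumr (parallel_channel hC).2 mulr1.
rewrite /Vpost -(sum_dffun_prod U) mulr_suml -big_split /=.
apply: ler_sum => y _.
have U_prod_ge0 : 0 <= \prod_i U i (y i) / a ^+ n.
  by rewrite divr_ge0 ?exprn_ge0 ?(ltW a_gt0) ?prodr_ge0.
have S_ge0 : 0 <= \sum_(x in X') pi x * parallel C x y.
  by apply: sumr_ge0 => x _; rewrite mulr_ge0.
apply: bigmax_le => [|x _]; first exact: addr_ge0.
have [xX'|xX'] := boolP (x \in X').
  rewrite ler_wpDl // (bigD1 x) //= lerDl.
  by apply: sumr_ge0 => z _; rewrite mulr_ge0.
apply: ler_wpDr => //; have [->|pix] := eqVneq (pi x) 0; first by rewrite mul0r.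
rewrite ler_pdivlMr ?exprn_gt0 //.
(* Raising [a] to [pi x] in the [n] factors gives one copy of [pi x] to each of the [n.+1]
   components. *)
apply: (@le_trans _ _ (pi x ^+ n.+1 * parallel C x y)).
  rewrite exprS mulrAC ler_wpM2r // ler_wpM2l //.
  by apply: lerXn2r; rewrite ?nnegrE ?(ltW a_gt0) ?ha.
have -> : pi x ^+ n.+1 * parallel C x y = \prod_i (pi x * C i x (y i)).
  by rewrite big_split /= prodr_const card_ord.
apply: ler_prod => i _; rewrite mulr_ge0 //=.
exact: (le_bigmax _ (fun x => pi x * C i x (y i))).
Qed.

(** Any point [x0] outside [X'] is at least as likely as every point of [X'], so removing [X'] keeps
    the maximum. *)
Lemma ler_V_restrict (R : realType) (X : finType) (pi : X -> R) (X' : {set X}) :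
  X' \proper [set: X] ->
  \big[Num.max/0]_(x in X') pi x <= \big[Num.min/1]_(x in ~: X') pi x ->
  V pi <= V (restrict pi (~: X')).
Proof.
move=> /properP[_ [x0 _ x0X']] hX'.
have restr_le x : x \notin X' -> pi x <= V (restrict pi (~: X')).
  move=> xX'; have -> : pi x = restrict pi (~: X') x by rewrite /restrict inE xX'.
  exact: (le_bigmax _ (restrict pi (~: X'))).
apply: bigmax_le => [|x _]; first exact: bigmax_ge_id.
have [xX'|/restr_le//] := boolP (x \in X').
apply: le_trans (restr_le x0 x0X').
apply: le_trans (le_trans hX' _); first exact: (le_bigmax_cond _ pi).
by apply: (bigmin_le_cond _ pi); rewrite inE.
Qed.

Theorem proposition5p6 (R : realType) (n : nat) (n_gt0 : (0 < n)%N)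
  (X : finType) (X_gt0 : (0 < #|X|)%N)
  (Y : 'I_n -> finType) (Y_gt0 : forall i, (0 < #|Y i|)%N)
  (C : forall i : 'I_n, X -> Y i -> R) (hC : forall i, is_channel (C i))
  (pi : X -> R) (hpi : is_prior pi)
  (X' : {set X}) (X'_neq0 : X' != set0) (X'_proper : X' \proper [set: X])
  (hX' : \big[Num.max/0]_(x in X') pi x <= \big[Num.min/1]_(x in ~: X') pi x) :
  let eps := \sum_(x in X') pi x in
  let pi' := restrict pi (~: X') in
  let M := \big[Num.max/0]_(j < n) Vpost pi (C j) in
  eps < M ->
  Iinf pi (parallel C) <=
    \sum_(i < n) Iinf pi (C i)
    + (n%:R - 1) * (Hmin pi' - Hinf pi')
    + log2 (M / (M - eps)).
Proof.
(* From here on there are [n.+1] channels, and [n] is the factor written [n%:R - 1] in the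
   statement. *)
case: n n_gt0 Y Y_gt0 C hC => // n _ Y _ C hC eps pi' M eps_lt_M.
have pi_ge0 := hpi.1.
have V0 := V_gt0 hpi.
have VV' : V pi <= V pi' by apply: ler_V_restrict.
have Vi0 i : 0 < Vpost pi (C i) := lt_le_trans V0 (ler_V_Vpost pi (hC i)).
have W0 : 0 < Vpost pi (parallel C) :=
  lt_le_trans V0 (ler_V_Vpost pi (parallel_channel hC)).
have eps_ge0 : 0 <= eps by apply: sumr_ge0.
have M0 : 0 < M := le_lt_trans eps_ge0 eps_lt_M.
have Me0 : 0 < M - eps by rewrite subr_gt0.
have MW : M <= Vpost pi (parallel C).
  by apply: bigmax_le => [|j _]; [exact: ltW | exact: ler_Vpost_parallel].
set a := \big[Num.min/1]_(x | pi' x != 0) pi' x.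
have a0 : 0 < a.
  apply: lt_bigmin => // x; rewrite lt_def => -> /=.
  by rewrite /pi' /restrict; case: ifP.
have ha x : x \notin X' -> pi x != 0 -> a <= pi x.
  move=> xX' pix; have pi'x : pi' x = pi x by rewrite /pi' /restrict inE xX'.
  by rewrite -pi'x; apply: (bigmin_le_cond _ pi'); rewrite pi'x.
have W_le := Vpost_parallel_le hC pi_ge0 a0 ha.
have prod0 : 0 < \prod_i Vpost pi (C i) by apply: prodr_gt0.
have W_le' : Vpost pi (parallel C) * a ^+ n <=
    \prod_i Vpost pi (C i) * (M / (M - eps)).
  rewrite -ler_pdivlMr ?exprn_gt0 // mulrAC mulrA ler_pdivlMr //.
  set B := _ / _ in W_le *; rewrite -/eps in W_le.
  (* With [W] for the vulnerability of the composition, [W <= B + eps] and [M <= W] give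
     [W * M <= B * M + eps * W]. *)
  have : eps * M <= eps * Vpost pi (parallel C) by apply: ler_wpM2l.
  have : Vpost pi (parallel C) * M <= (B + eps) * M by rewrite ler_pM2r.
  lra.
have a_exp : log2 (a ^+ n) = n%:R * log2 a.
  by rewrite /log2 lnXn // -[ln a *+ n]mulr_natl mulrA.
have := ler_log2 (mulr_gt0 W0 (exprn_gt0 n a0)) W_le'.
have MMe0 : 0 < M / (M - eps) by apply: divr_gt0.
rewrite (log2M W0) ?exprn_gt0 // (log2M prod0 MMe0) log2_prod // a_exp.
(* The sum of leakages has [n] more copies of [Hinf pi] than the left side; they outweigh the [n]
   subtracted copies of [Hinf pi']. *)
have : n%:R * log2 (V pi) <= n%:R * log2 (V pi').
  by rewrite ler_wpM2l ?ler0n // ler_log2.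
rewrite /Iinf /Hinf /Hinf_post /Hmin -/a.
rewrite big_split /= sumr_const card_ord -mulr_natl.
under [X in _ -> _ -> _ <= _ + X + _ + _]eq_bigr do rewrite opprK.
rewrite -natr1; lra.
Qed.
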